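(* Let $n\geq 3$ be an integer, and run the following recursive search procedure for $n$, starting from the triple $(p,s,i)=(1,0,0)$ and the empty candidate sequence. The procedure, called with a triple $(p,s,i)$ and a current candidate $(a_1,\dots,a_i)$, does the following: let $m:=a_i$ if $i\geq 1$ and $m:=n$ if $i=0$; for each $a'=2,3,\dots,m$ in increasing order, set $a_{i+1}:=a'$, $s':=s+a'$, $p':=p\cdot a'$, and then: if $p'>s'+n-(i+1)$, discard this choice and continue with the next $a'$; if $p'=s'+n-(i+1)$, record the sequence $(a_1,\dots,a_i,a_{i+1},1,\dots,1)$ of length $n$ (with $n-i-1$ trailing ones) as a solution and continue with the next $a'$; otherwise (i.e. $p'<s'+n-(i+1)$) call the procedure recursively with $(p',s',i+1)$ and candidate $(a_1,\dots,a_{i+1})$, and after it returns continue with the next $a'$. After all values of $a'$ have been tried, the call returns. Then the procedure records every non-increasing sequence $(a_1,\dots,a_n)$ of positive integers with $a_1\geq a_2\geq\dots\geq a_n$ satisfying $\prod_{i=1}^n a_i=\sum_{i=1}^n a_i$, and the last solution it records is the basic solution $(n,2,1,\dots,1)$.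
   Context: All sequences are of positive integers and are taken non-increasing, $a_1\geq a_2\geq\cdots$. The basic solution of length $n$ is $a_1=n$, $a_2=2$, $a_3=\dots=a_n=1$, which always satisfies $\prod_{i=1}^n a_i=\sum_{i=1}^n a_i$. *)

(* Defs.v *)
From mathcomp Require Import all_boot.
From mathcomp Require Import zify.
Set Implicit Arguments.
Unset Strict Implicit.
Unset Printing Implicit Defensive.

Definition nonincreasing_solution (n : nat) (a : n.-tuple nat) : Prop :=
  [/\ forall i : 'I_n, 0 < tnth a i,
      forall i j : 'I_n, i <= j -> tnth a j <= tnth a i
    & \prod_(i < n) tnth a i = \sum_(i < n) tnth a i].

Definition basic_solution (n : nat) : seq nat := [:: n, 2 & nseq (n - 2) 1].

(* a_i is [nth 0 a i.-1], as [nth] counts from 0. *)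
Definition search_bound (n i : nat) (a : seq nat) : nat :=
  if i is j.+1 then nth 0 a j else n.

(* Big-step semantics of the loop of one call.  [search_loop n p s i a vs out]:
   in the call with triple (p, s, i) and candidate a, processing the values vs
   still to be tried for a_(i+1) terminates, having recorded the sequences out,
   in chronological order.  The truncated subtractions agree with the integer
   ones in every execution started from (1, 0, 0) with 3 <= n: s + a' is a sum
   of i.+1 integers that are at least 2, and a recursive call is made only when
   i.+1 < n. *)
Inductive search_loop (n : nat) :
    nat -> nat -> nat -> seq nat -> seq nat -> seq (seq nat) -> Prop :=
| SearchDone p s i a :
    search_loop n p s i a [::] [::]
| SearchDiscard p s i a a' vs out :
    p * a' > s + a' + n - i.+1 ->
    search_loop n p s i a vs out ->
    search_loop n p s i a (a' :: vs) out
| SearchRecord p s i a a' vs out :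
    p * a' = s + a' + n - i.+1 ->
    search_loop n p s i a vs out ->
    search_loop n p s i a (a' :: vs)
      ((rcons a a' ++ nseq (n - i.+1) 1) :: out)
| SearchRecurse p s i a a' vs out1 out2 :
    p * a' < s + a' + n - i.+1 ->
    search_loop n (p * a') (s + a') i.+1 (rcons a a')
      (index_iota 2 (search_bound n i.+1 (rcons a a')).+1) out1 ->
    search_loop n p s i a vs out2 ->
    search_loop n p s i a (a' :: vs) (out1 ++ out2).

Definition search_call (n p s i : nat) (a : seq nat) (out : seq (seq nat)) :=
  search_loop n p s i a (index_iota 2 (search_bound n i a).+1) out.

Lemma search_loop_det n p s i a vs out out' :
  search_loop n p s i a vs out -> search_loop n p s i a vs out' -> out = out'.
Proof.
move=> H; elim: H out' => {p s i a vs out}.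
- by move=> p s i a out' H; inversion H.
- move=> p s i a a' vs out c _ IH out' H.
  inversion H; subst; try (exfalso; lia).
  by apply: IH.
- move=> p s i a a' vs out c _ IH out' H.
  inversion H; subst; try (exfalso; lia).
  by congr cons; apply: IH.
- move=> p s i a a' vs out1 out2 c _ IH1 _ IH2 out' H.
  inversion H; subst; try (exfalso; lia).
  by congr cat; [apply: IH1 | apply: IH2].
Qed.

(* The records of a terminating call are unique, so an existential statement
   about them is a statement about the execution. *)
Lemma search_call_det n p s i a out out' :
  search_call n p s i a out -> search_call n p s i a out' -> out = out'.
Proof. exact: search_loop_det. Qed.

(* Main.v *)
Require Import Defs.
From mathcomp Require Import all_boot.
From mathcomp Require Import zify.
Set Implicit Arguments.
Unset Strict Implicit.
Unset Printing Implicit Defensive.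

(** For a candidate of length [k] with product [p] and sum [s], put
    [d = p - s - (n - k)], the difference of product and sum after padding with
    ones.  Appending an entry [x >= 1] increases [d] by [(p - 1) * (x - 1)], so
    [d > 0] excludes every extension, [d = 0] leaves only the extension by ones,
    and [d < 0] forces the next entry to be at least [2].  A candidate with
    entries at least [2] has [p >= s], so [d < 0] implies [k < n]; hence the
    recursion terminates.  The same monotonicity, applied to all entries but the
    first, gives [a_1 <= n].  The last branch [a_1 = n] has [d = 0] for
    [a_2 = 2] and [d > 0] for [a_2 > 2], so it records the basic solution
    only. *)

(** Multiplying by an entry [x] adds [p * (x - 1) >= x - 1] to the product. *)
Lemma leq_add_sumn_muln_prod (p : nat) (r : seq nat) :
  0 < p -> all (leq 1) r ->
  p + sumn r <= p * (\prod_(x <- r) x) + size r.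
Proof.
elim: r p => [|x r IH] p p_gt0 /=; first by rewrite big_nil; lia.
case/andP=> x_gt0 r_gt0; rewrite big_cons mulnA.
have /IH/(_ r_gt0) : 0 < p * x by rewrite muln_gt0 p_gt0.
nia.
Qed.

(** For [p > 1] the gain [p * (x - 1)] exceeds [x - 1] unless [x = 1]. *)
Lemma eq_add_sumn_muln_prod (p : nat) (r : seq nat) :
  1 < p -> all (leq 1) r ->
  p + sumn r = p * (\prod_(x <- r) x) + size r -> r = nseq (size r) 1.
Proof.
elim: r p => [|x r IH] p p_gt1 //= /andP[x_gt0 r_gt0].
rewrite big_cons mulnA => eq_pr.
have px_gt0 : 0 < p * x by rewrite muln_gt0 x_gt0 (ltnW p_gt1).
have le_pxr := leq_add_sumn_muln_prod px_gt0 r_gt0.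
have x1 : x = 1 by nia.
rewrite x1 in eq_pr *; congr cons; apply: (IH p) => //; lia.
Qed.

Lemma sorted_geq_nseq1 (r : seq nat) :
  all (leq 1) r -> path geq 1 r -> r = nseq (size r) 1.
Proof.
elim: r => //= x r IH /andP[x_gt0 r_gt0] /andP[x_le1 xr].
have x1 : x = 1 by lia.
by rewrite x1 in xr *; rewrite {1}IH.
Qed.

Lemma prod_nseq1 (k : nat) : \prod_(x <- nseq k 1) x = 1.
Proof. by rewrite big_nseq iter_muln_1 exp1n. Qed.

(** Induction on the execution, following a solution that extends [c] through its next entry [x] and
    its remainder [r]. *)
Lemma search_loop_complete n p s i c vs out :
  search_loop n p s i c vs out -> size c = i -> 0 < p -> i < n ->
  forall (x : nat) (r : seq nat), x \in vs -> all (leq 1) (x :: r) -> path geq x r ->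
    size r = n - i.+1 ->
    p * x * (\prod_(y <- r) y) = s + x + sumn r ->
    c ++ x :: r \in out.
Proof.
elim=> {p s i c vs out} //.
- move=> p s i c a' vs out big _ IH szc p_gt0 lt_in x r.
  rewrite inE => /orP[/eqP->|]; last by move=> *; apply: IH.
  move=> /= /andP[x_gt0 r_gt0] _ szr eqpr.
  have pa_gt0 : 0 < p * a' by rewrite muln_gt0 p_gt0.
  have := leq_add_sumn_muln_prod pa_gt0 r_gt0; lia.
- move=> p s i c a' vs out eqp _ IH szc p_gt0 lt_in x r.
  rewrite !inE => /orP[/eqP->|]; last by move=> *; rewrite IH ?orbT.
  move=> /= /andP[x_gt0 r_gt0] _ szr eqpr.
  apply/orP; left; rewrite cat_rcons -szr.
  suff <- : r = nseq (size r) 1 by [].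
  (* A nonempty [r] makes [n - i.+1] positive, whence [p * a' > 1]. *)
  have [r0|r_neq0] := eqVneq (size r) 0; first by rewrite (size0nil r0).
  by apply: (@eq_add_sumn_muln_prod (p * a')) => //; lia.
- move=> p s i c a' vs out1 out2 lt_p _ IH1 _ IH2 szc p_gt0 lt_in x r.
  rewrite mem_cat inE => /orP[/eqP->|]; last by move=> *; rewrite IH2 ?orbT.
  move=> /= /andP[x_gt0 r_gt0] xr szr eqpr; apply/orP; left.
  case: r => [|y r] in r_gt0 xr szr eqpr *.
    by move: eqpr szr; rewrite big_nil /=; lia.
  move: r_gt0 xr => /= /andP[y_gt0 r_gt0] /andP[le_yx yr].
  (* If [y = 1], all later entries are 1 and [eqpr] contradicts [lt_p]. *)
  have y_gt1 : 1 < y.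
    rewrite ltnNge; apply/negP => y_le1; have y1 : y = 1 by lia.
    move: yr eqpr szr; rewrite y1 => /(sorted_geq_nseq1 r_gt0) ->.
    by rewrite big_cons prod_nseq1 /= sumn_nseq size_nseq; lia.
  rewrite -cat_rcons; apply: IH1 => //=.
  + by rewrite size_rcons szc.
  + by rewrite muln_gt0 p_gt0.
  + by move: szr => /=; lia.
  + by rewrite nth_rcons szc ltnn eqxx mem_index_iota; lia.
  + by rewrite y_gt0.
  + by move: szr => /=; lia.
  + by move: eqpr; rewrite big_cons /=; lia.
Qed.

(* [s + 2 <= 2 * p] is the weakest condition that gives [s + a' <= p * a'] for
   all [a' >= 2]; it holds for (1, 0) and survives the recursive call. *)
Lemma search_loop_terminates n p s i c vs :
  s + 2 <= 2 * p -> all (leq 2) vs -> exists out, search_loop n p s i c vs out.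
Proof.
have [k] := ubnP (n - i).
elim: k => // k IHk in p s i c vs *.
rewrite ltnS => le_k le_sp; elim: vs => [|a' vs IHvs] /=.
  by exists [::]; constructor.
case/andP=> a'_gt1 /IHvs[out out_run].
case: (ltngtP (p * a') (s + a' + n - i.+1)) => cmp.
- have [|||out1 out1_run] := IHk (p * a') (s + a') i.+1 (rcons c a')
    (index_iota 2 (search_bound n i.+1 (rcons c a')).+1) _ _.
  (* With [cmp] this gives [i.+1 < n], so the measure [n - i] drops. *)
  + have : s + a' <= p * a' by nia.
    lia.
  + by nia.
  + by apply/allP => x; rewrite mem_index_iota => /andP[].
  by exists (out1 ++ out); apply: SearchRecurse.
- by exists out; apply: SearchDiscard.
- by eexists; apply: SearchRecord out_run.
Qed.

Lemma search_loop_cat n p s i c vs1 vs2 out1 out2 :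
  search_loop n p s i c vs1 out1 -> search_loop n p s i c vs2 out2 ->
  search_loop n p s i c (vs1 ++ vs2) (out1 ++ out2).
Proof.
elim=> {p s i c vs1 out1} //=.
- by move=> p s i c a' vs out cmp _ IH /IH; apply: SearchDiscard.
- by move=> p s i c a' vs out cmp _ IH /IH; apply: SearchRecord.
- move=> p s i c a' vs o1 o2 cmp run1 _ _ IH /IH run2.
  by rewrite -catA; apply: SearchRecurse.
Qed.

Lemma search_loop_discard_all n p s i c vs :
  all (fun a' => s + a' + n - i.+1 < p * a') vs ->
  search_loop n p s i c vs [::].
Proof.
elim: vs => [|a' vs IH] /=; first by constructor.
by case/andP=> cmp /IH; apply: SearchDiscard.
Qed.

Lemma search_loop_last_branch n :
  3 <= n -> search_loop n 1 0 0 [::] [:: n] [:: basic_solution n].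
Proof.
move=> n_ge3; rewrite -[[:: basic_solution n]]cats0.
apply: SearchRecurse; [lia | rewrite /= | exact: SearchDone].
rewrite [index_iota 2 _](_ : _ = 2 :: index_iota 3 n.+1); last first.
  by rewrite /index_iota !subSS -[n - 1]prednK //; [congr (_ :: iota _ _); lia | lia].
apply: SearchRecord; first by lia.
apply: search_loop_discard_all; apply/allP => x.
rewrite mem_index_iota => /andP[x_ge3 _]; nia.
Qed.

Lemma nonincreasing_solution_seq n (a : n.-tuple nat) :
  nonincreasing_solution a ->
  [/\ all (leq 1) a, sorted geq a & \prod_(x <- a) x = sumn a].
Proof.
case=> a_gt0 a_noninc eq_a; split.
- by apply/all_tnthP.
- apply/(sortedP 0) => i; rewrite size_tuple => lt_in.
  have := a_noninc (Ordinal (ltnW lt_in)) (Ordinal lt_in) (leqnSn i).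
  by rewrite !(tnth_nth 0).
- by rewrite sumnE !big_tuple.
Qed.

Lemma solution_head_bounds x r :
  0 < size r -> all (leq 1) (x :: r) -> path geq x r ->
  x * (\prod_(y <- r) y) = x + sumn r -> 2 <= x <= (size r).+1.
Proof.
move=> r_neq0 /= /andP[x_gt0 r_gt0] xr eq_xr; apply/andP; split.
  rewrite ltnNge; apply/negP => x_le1; have x1 : x = 1 by lia.
  move: xr eq_xr; rewrite x1 => /(sorted_geq_nseq1 r_gt0) r1.
  by move: r_neq0; rewrite r1 prod_nseq1 sumn_nseq size_nseq; lia.
have := leq_add_sumn_muln_prod (ltn0Sn 0) r_gt0; rewrite mul1n.
have le_rs : size r <= sumn r.
  by elim: r r_gt0 {r_neq0 xr eq_xr} => //= y r IH /andP[? /IH]; lia.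
(* Here [x * (q - 1) = sumn r <= (q - 1) + size r], so [(x - 1) * (q - 1) <= size r]. *)
move: (\prod_(y <- r) y) eq_xr => q eq_xr le_rq.
have q_gt1 : 1 < q by nia.
nia.
Qed.

Theorem theorem2p2 (n : nat) (hn : 3 <= n) :
  exists recs : seq (seq nat),
    [/\ search_call n 1 0 0 [::] recs,
        forall a : n.-tuple nat,
          nonincreasing_solution a -> tval a \in recs
      & exists recs0 : seq (seq nat),
          recs = rcons recs0 (basic_solution n)].
Proof.
have [||recs0 run0] :=
  @search_loop_terminates n 1 0 0 [::] (index_iota 2 n) _ _ => //.
  by apply/allP => x; rewrite mem_index_iota => /andP[].
have run : search_call n 1 0 0 [::] (rcons recs0 (basic_solution n)).
  rewrite /search_call /= -cats1.
  (* Splitting off the value [n] puts the records of its branch last. *)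
  rewrite [index_iota _ _](_ : _ = index_iota 2 n ++ [:: n]).
    exact: search_loop_cat run0 (search_loop_last_branch hn).
  by rewrite /index_iota subSn ?(ltnW hn) // -[(n - 2).+1]addn1 iotaD subnKC ?(ltnW hn).
exists (rcons recs0 (basic_solution n)); split=> //; last by exists recs0.
move=> a /nonincreasing_solution_seq[].
have := size_tuple a; case: (tval a) => [|x r] /=; first by lia.
move=> sz_r a_gt0 xr; rewrite big_cons => eq_xr.
have /andP[x_ge2 x_le] : 2 <= x <= (size r).+1.
  by apply: solution_head_bounds => //; lia.
apply: (search_loop_complete run) => //=; [lia | | lia | lia].
by rewrite mem_index_iota; lia.
Qed.
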